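(* Let $k \geq 8$ be an integer, let $L$ be a lattice of rank $n \geq k$, and let $v_1, \dots, v_n$ be a Minkowski basis of $L$. Then $$\|v_k\|^2 \leq \frac{608}{625} \left( \frac{5}{4} \right)^{k - 4} \lambda_k(L)^2.$$
   Context: A lattice is a discrete subgroup $L$ of some $\mathbb{R}^m$; its rank $n$ is the dimension of $\mathrm{span}_{\mathbb{R}}(L)$. $\|\cdot\|$ is the Euclidean norm. A basis of $L$ is a linearly independent sequence $b_1, \dots, b_n \in L$ with $\mathrm{span}_{\mathbb{Z}}(b_1, \dots, b_n) = L$. The $i$-th successive minimum $\lambda_i(L)$ is the smallest real number such that there are $i$ linearly independent vectors in $L$ of length at most $\lambda_i(L)$. A sequence $b_1, \dots, b_i \in L$ is called primitive if it can be completed to a basis $b_1, \dots, b_n$ of $L$. A basis $b_1, \dots, b_n$ of $L$ is a Minkowski basis if, for each $i$, $b_i$ is a vector of smallest length among all vectors $b \in L$ such that $b_1, \dots, b_{i-1}, b$ is primitive (ties are resolved arbitrarily). *)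

(* Defs.v *)
From mathcomp Require Import all_boot all_order all_algebra.
From mathcomp Require Import all_classical all_reals all_analysis.
Set Implicit Arguments.
Unset Strict Implicit.
Unset Printing Implicit Defensive.
Import Order.TTheory GRing.Theory Num.Theory.
Import numFieldNormedType.Exports.
Local Open Scope classical_set_scope.
Local Open Scope ring_scope.

(* The library norm on ['rV[R]_m] is the sup norm; the topology it induces is
   the usual one, so only the norm has to be redefined. *)
Definition enorm (R : realType) (m : nat) (x : 'rV[R]_m) : R :=
  Num.sqrt (\sum_(j < m) x 0 j ^+ 2).

Definition is_lattice (R : realType) (m : nat) (L : set 'rV[R]_m) : Prop :=
  [/\ L 0, forall x y, L x -> L y -> L (x - y) & L `<=` isolated L].

Definition real_span (R : realType) (m : nat) (L : set 'rV[R]_m) :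
    set 'rV[R]_m :=
  [set x | exists2 s : seq 'rV[R]_m, [set` s] `<=` L & x \in << s >>%VS].

Definition has_rank (R : realType) (m : nat) (L : set 'rV[R]_m) (n : nat) :
    Prop :=
  exists2 U : {vspace 'rV[R]_m}, [set` U] = real_span L & \dim U = n.

Definition lattice_basis (R : realType) (m : nat) (L : set 'rV[R]_m)
    (b : seq 'rV[R]_m) : Prop :=
  [/\ free b, [set` b] `<=` L & [set x | inIntSpan (in_tuple b) x] = L].

Definition primitive (R : realType) (m : nat) (L : set 'rV[R]_m)
    (s : seq 'rV[R]_m) : Prop :=
  exists t : seq 'rV[R]_m, lattice_basis L (s ++ t).

(* For [L] a lattice and [1 <= i <= rank L] the set below is nonempty and, by
   discreteness of [L], its infimum is attained. *)
Definition succ_min (R : realType) (m : nat) (L : set 'rV[R]_m) (i : nat) : R :=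
  inf [set r | exists s : i.-tuple 'rV[R]_m,
    [/\ free s, [set` s] `<=` L & forall x, x \in s -> enorm x <= r]].

Definition shortest_in (R : realType) (m : nat) (A : set 'rV[R]_m)
    (x : 'rV[R]_m) : Prop :=
  A x /\ forall y, A y -> enorm x <= enorm y.

(* Indices start at 0: [take i b] is the sequence of vectors preceding [b`_i]. *)
Definition minkowski_basis (R : realType) (m : nat) (L : set 'rV[R]_m)
    (b : seq 'rV[R]_m) : Prop :=
  lattice_basis L b /\
  forall i : nat, (i < size b)%N ->
    shortest_in [set x | L x /\ primitive L (rcons (take i b) x)] b`_i.

(* Main.v *)
(* Let [r] bound the lengths of [k] linearly independent vectors of [L], and
   put 0-based indices on the basis. For [j < k] one of these vectors, say
   [w = \sum_i c_i v_i], lies outside the span of [v_0 .. v_(j-1)]. Let [g] be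
   the gcd of the [c_i] with [i >= j]. Then [w / g] can be moved by a real
   combination of [v_0 .. v_(j-1)] to a vector extending them primitively, and
   randomized rounding of its coefficients yields
     |v_j|^2 <= |w|^2 / g^2 + 1/4 \sum_(i < j, g does not divide c_i) |v_i|^2.
   If [g] is 2 or 3 and does not divide [c_i], the gcd of [c_i, c_(i+1), ..] is
   1, so [w] itself extends [v_0 .. v_(i-1)] primitively and [|v_i| <= |w|].
   Hence |v_j|^2 is at most r^2, (j+1)/4 r^2 or r^2/16 + 1/4 \sum_(i < j) |v_i|^2.
   This gives the constants 1, 1, 1, 1, 5/4, 3/2, 7/4 for [j < 7], and then
   19/8 (5/4)^(j-7), where 19/8 = 608/625 (5/4)^4. *)
Require Import Defs.
From HB Require Import structures.
From mathcomp Require Import all_boot all_order all_algebra.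
From mathcomp Require Import all_classical all_reals all_analysis.
From mathcomp Require Import ring lra.
Import Order.TTheory GRing.Theory Num.Theory.
Import numFieldNormedType.Exports.
Local Open Scope classical_set_scope.
Local Open Scope ring_scope.

(** * Integer spans and gcds *)

(** Made boolean by [asbool] so that it can carry a [zmodClosed] structure; only the first [size s]
    values of [c] matter. *)
Definition zspan {V : zmodType} (s : seq V) : {pred V} :=
  [pred x | `[< exists c : nat -> int, x = \sum_(i < size s) s`_i *~ c i >]].

Lemma zspanP {V : zmodType} (s : seq V) (x : V) :
  reflect (exists c : nat -> int, x = \sum_(i < size s) s`_i *~ c i)
          (x \in zspan s).
Proof. by rewrite inE; apply: asboolP. Qed.

Lemma zspan_zmod_closed {V : zmodType} (s : seq V) : zmod_closed (zspan s).
Proof.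
split=> [|x y /zspanP[c ->] /zspanP[d ->]]; apply/zspanP.
  by exists (fun=> 0); rewrite big1 // => i _; rewrite mulr0z.
exists (fun i => c i - d i); rewrite -sumrB; apply: eq_bigr => i _.
by rewrite mulrzBr.
Qed.

HB.instance Definition _ (V : zmodType) (s : seq V) :=
  GRing.isZmodClosed.Build V (zspan s) (zspan_zmod_closed s).

Lemma mem_zspan {V : zmodType} (s : seq V) (x : V) : x \in s -> x \in zspan s.
Proof.
move=> /(nthP 0)[i lti <-]; apply/zspanP; exists (fun j => (j == i)%:Z).
rewrite (bigD1 (Ordinal lti)) //= eqxx mulr1z big1 ?addr0 // => j.
by rewrite -val_eqE /= => /negPf->; rewrite mulr0z.
Qed.

Lemma zspan_sub {V : zmodType} (s : seq V) (S : zmodClosed V) :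
  {subset s <= S} -> {subset zspan s <= S}.
Proof.
move=> sS x /zspanP[c ->]; apply: rpred_sum => i _.
by apply: rpredMz; apply: sS; rewrite mem_nth.
Qed.

Lemma dvdz_foldr_gcdz (d : int) (s : seq int) :
  (d %| foldr gcdz 0 s)%Z = all (fun c => d %| c)%Z s.
Proof. by elim: s => [|c s IH] /=; rewrite ?dvdz0 // dvdz_gcd IH. Qed.

(** Supplies the first row [(m', n')] and the second row [(-b, a)] of an integer matrix of
    determinant 1. When the gcd is 0, both integers vanish and any such matrix will do. *)
Lemma gcdz_bezout_factors (m n : int) :
  exists m' n' a b, [/\ m = m' * gcdz m n, n = n' * gcdz m n
                      & a * m' + b * n' = 1].
Proof.
have [g0|gN0] := eqVneq (gcdz m n) 0.
  exists 1, 0, 1, 0; move/eqP: (g0); rewrite gcdz_eq0 g0.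
  by case/andP=> /eqP-> /eqP->.
have [a [b Eab]] := Bezoutz m n.
exists (m %/ gcdz m n)%Z, (n %/ gcdz m n)%Z, a, b.
rewrite !divzK ?dvdz_gcdl ?dvdz_gcdr //; split=> //.
by apply: (mulIf gN0); rewrite mul1r mulrDl -!mulrA !divzK ?dvdz_gcdl ?dvdz_gcdr.
Qed.

(** Euclid's algorithm on the generators: by induction the tail is carried by one vector [y] with
    its gcd as coefficient, and a unimodular change of the pair [x, y] merges the two coefficients
    into their gcd. *)
Lemma zspan_gcd_completion {V : zmodType} (u : seq V) (cs : seq int) :
  size u = size cs -> (0 < size u)%N ->
  exists y : V, exists u' : seq V,
    [/\ size (y :: u') = size u,
        \sum_(i < size u) u`_i *~ cs`_i = y *~ foldr gcdz 0 cs,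
        {subset y :: u' <= zspan u} & {subset u <= zspan (y :: u')}].
Proof.
elim: u cs => [//|x u IH] [//|c cs] /= [szu] _.
case: u IH szu => [|x1 u] IH szu.
  have {szu}-> : cs = [::] by case: cs szu.
  (* Since [gcdz c 0] is the absolute value of [c], the generator absorbs the sign. *)
  exists (x *~ (-1) ^+ (c < 0)%R), [::]; split => //=.
  - by rewrite big_ord1 /= gcdz0 -mulrzA -intEsign.
  - by move=> z; rewrite mem_seq1 => /eqP->; apply: rpredMz; apply/mem_zspan/mem_head.
  - move=> z; rewrite mem_seq1 => /eqP->.
    have {1}-> : x = x *~ (-1) ^+ (c < 0)%R *~ (-1) ^+ (c < 0)%R.
      by rewrite -mulrzA -expr2 sqrr_sign.
    exact/rpredMz/mem_zspan/mem_head.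
have [y [u' [szu' Ey sub1 sub2]]] := IH _ szu isT.
set g1 := foldr gcdz 0 cs in Ey *; rewrite big_ord_recl /= Ey.
have [c' [g' [a [b]]]] := gcdz_bezout_factors c g1.
set g := gcdz c g1 => -[Ec Eg det1].
(* The change of generators has determinant [a * c' + b * g' = 1]; [Ex] and [Ey'] invert it. *)
pose w := x *~ c' + y *~ g'; pose z := y *~ a - x *~ b.
have Ex : x = w *~ a - z *~ g'.
  rewrite /w /z mulrzDl mulrzBl -!mulrzA (mulrC a g') opprB addrACA subrr addr0.
  by rewrite -mulrzDr (mulrC c') det1.
have Ey' : y = w *~ b + z *~ c'.
  rewrite /w /z mulrzDl mulrzBl -!mulrzA (mulrC c' b) (addrC (x *~ _)) addrACA.
  by rewrite subrr addr0 -mulrzDr (mulrC g') addrC det1.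
exists w, (z :: u'); split => /=.
- by case: szu' => ->.
- by rewrite mulrzDl -!mulrzA -Ec -Eg.
- have xS : x \in zspan [:: x, x1 & u] by apply/mem_zspan/mem_head.
  have sub3 : {subset x1 :: u <= zspan [:: x, x1 & u]}.
    by move=> t tu; apply: mem_zspan; rewrite in_cons tu orbT.
  have sub4 : {subset y :: u' <= zspan [:: x, x1 & u]}.
    by move=> t /sub1; apply: zspan_sub.
  have yS := sub4 _ (mem_head _ _).
  move=> t; rewrite !in_cons => /or3P[/eqP->|/eqP->|tu'].
  + by rewrite rpredD ?rpredMz.
  + by rewrite rpredB ?rpredMz.
  + by apply: sub4; rewrite in_cons tu' orbT.
have wS : w \in zspan [:: w, z & u'] by apply/mem_zspan/mem_head.
have zS : z \in zspan [:: w, z & u'] by apply/mem_zspan; rewrite !in_cons eqxx orbT.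
move=> t; rewrite in_cons => /orP[/eqP->|/sub2].
  by rewrite Ex rpredB ?rpredMz.
apply: zspan_sub => {}t; rewrite in_cons => /orP[/eqP->|tu'].
  by rewrite Ey' rpredD ?rpredMz.
by apply: mem_zspan; rewrite !in_cons tu' !orbT.
Qed.

(** * Lattice bases and primitive sequences *)

Lemma lattice_basisP {R : realType} {m : nat} (L : set 'rV[R]_m)
    (b : seq 'rV[R]_m) :
  lattice_basis L b <-> free b /\ L = [set` zspan b].
Proof.
have E : [set x | inIntSpan (in_tuple b) x] = [set` zspan b].
  apply/seteqP; split=> x /=.
    case=> a ->; apply: rpred_sum => i _; apply/rpredMz/mem_zspan.
    exact: mem_nth.
  by case/zspanP=> c ->; exists [ffun i : 'I_(size b) => c i];
    apply: eq_bigr => i _; rewrite ffunE.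
split=> [[fb _ <-]|[fb ->]]; split=> //.
by move=> x /= xb; apply: mem_zspan.
Qed.

(** Freeness of [b'] is a dimension count: its real span contains that of [b], and the two sequences
    have the same size. *)
Lemma lattice_basis_exchange {R : realType} {m : nat} (L : set 'rV[R]_m)
    (b b' : seq 'rV[R]_m) :
  lattice_basis L b -> size b' = size b -> {subset b' <= zspan b} ->
  {subset b <= zspan b'} -> lattice_basis L b'.
Proof.
move=> /lattice_basisP[fb ->] szb b'b bb'; apply/lattice_basisP; split.
  rewrite /free eqn_leq dim_span szb -(eqP fb); apply/dimvS/span_subvP => x xb.
  by apply: (@zspan_sub _ b' <<b'>>%VS) (bb' _ xb) => y; apply: memv_span.
by apply/seteqP; split=> x; apply: zspan_sub.
Qed.

(** Gcd completion turns [drop j v] into [b :: u']. Adding to [b] an integer combination of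
    [take j v] is invertible over the integers, so [u'] still completes the sequence to a basis. *)
Lemma primitive_gcd_decomposition {R : realType} {m : nat} (L : set 'rV[R]_m)
    (v : seq 'rV[R]_m) (cs : seq int) (j : nat) :
  lattice_basis L v -> size cs = size v -> (j < size v)%N ->
  exists b : 'rV[R]_m,
    \sum_(i < size v) v`_i *~ cs`_i =
      \sum_(i < j) v`_i *~ cs`_i + b *~ foldr gcdz 0 (drop j cs) /\
    forall d : nat -> int,
      primitive L (rcons (take j v) (\sum_(i < j) v`_i *~ d i + b)).
Proof.
move=> Lv szcs ltj.
have [||y [u' [szu' Ey sub1 sub2]]] :=
  @zspan_gcd_completion _ (drop j v) (drop j cs).
- by rewrite !size_drop szcs.
- by rewrite size_drop subn_gt0.
exists y; split=> [|d].
  rewrite -Ey -(big_mkord xpredT (fun i => v`_i *~ cs`_i)).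
  rewrite (@big_cat_nat _ _ _ j) //=; last exact: ltnW.
  rewrite big_mkord; congr (_ + _).
  rewrite -{1}[j]add0n big_addn big_mkord size_drop.
  by apply: eq_bigr => i _; rewrite !nth_drop addnC.
set x := _ + y; exists u'; rewrite cat_rcons.
have takeS i : (i < j)%N -> v`_i \in take j v.
  by move=> ij; rewrite -(nth_take 0 ij) mem_nth // size_take ltj.
apply: lattice_basis_exchange Lv _ _ _.
- rewrite size_cat -[size (x :: u')]/(size (y :: u')) szu'.
  by rewrite -size_cat cat_take_drop.
- have sub3 : {subset y :: u' <= zspan v}.
    by move=> t /sub1; apply: zspan_sub => {}t /mem_drop; apply: mem_zspan.
  move=> t; rewrite mem_cat in_cons => /or3P[/mem_take|/eqP->|tu'].
  + exact: mem_zspan.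
  + apply: rpredD; last by apply/sub3/mem_head.
    apply: rpred_sum => i _.
    by apply/rpredMz/mem_zspan/mem_nth/(ltn_trans _ ltj).
  + by rewrite sub3 // in_cons tu' orbT.
have sub4 : {subset take j v <= zspan (take j v ++ x :: u')}.
  by move=> t tv; apply: mem_zspan; rewrite mem_cat tv.
move=> t; rewrite -{1}(cat_take_drop j v) mem_cat => /orP[/sub4 //|/sub2].
apply: zspan_sub => {}t; rewrite in_cons => /orP[/eqP->|tu']; last first.
  by apply: mem_zspan; rewrite mem_cat in_cons tu' !orbT.
rewrite -[y](addKr (\sum_(i < j) v`_i *~ d i)) addrC rpredB //.
  by apply: mem_zspan; rewrite mem_cat mem_head orbT.
by apply: rpred_sum => i _; apply/rpredMz/sub4/takeS.
Qed.

(** * Euclidean norm and rounding of coefficients *)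

Lemma enorm_sqr {R : realType} {m : nat} (x : 'rV[R]_m) :
  enorm x ^+ 2 = \sum_(j < m) x 0 j ^+ 2.
Proof. by rewrite sqr_sqrtr // sumr_ge0 // => j _; apply: sqr_ge0. Qed.

Lemma enormZ_sqr {R : realType} {m : nat} (a : R) (x : 'rV[R]_m) :
  enorm (a *: x) ^+ 2 = a ^+ 2 * enorm x ^+ 2.
Proof.
by rewrite !enorm_sqr mulr_sumr; apply: eq_bigr => j _; rewrite mxE exprMn.
Qed.

(* Round [t] up or down at random with mean [0]: the cross terms vanish in
   expectation and the variance of the rounding error is at most [1 / 4]. *)
Lemma exists_rounding1 {R : realType} {m : nat} (x v : 'rV[R]_m) (t : R) :
  exists d : int, enorm (x + (d%:~R + t) *: v) ^+ 2 <=
    enorm x ^+ 2 + (if t \is a Num.int then 0 else 1 / 4) * enorm v ^+ 2.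
Proof.
have [/intrP[d ->]|_] := boolP (t \is a Num.int).
  by exists (- d); rewrite intrN addNr scale0r addr0 mul0r addr0.
pose f := t - (Num.floor t)%:~R.
have /andP[fge0 flt1] : 0 <= f < 1.
  by have := floor_itv t; rewrite intrD /f => /andP[? ?]; lra.
have avg : (1 - f) * enorm (x + f *: v) ^+ 2 + f * enorm (x + (f - 1) *: v) ^+ 2
    = enorm x ^+ 2 + f * (1 - f) * enorm v ^+ 2.
  rewrite !enorm_sqr !mulr_sumr -!big_split; apply: eq_bigr => j _.
  by rewrite !mxE /=; ring.
have v0 := sqr_ge0 (enorm v).
have var : f * (1 - f) * enorm v ^+ 2 <= 1 / 4 * enorm v ^+ 2.
  by apply: ler_wpM2r => //; have := sqr_ge0 (f - 1 / 2); lra.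
have [le1|gt1] := leP (enorm (x + f *: v) ^+ 2)
                      (enorm x ^+ 2 + 1 / 4 * enorm v ^+ 2).
  by exists (- Num.floor t); rewrite intrN addrC [_ + t]addrC addrC.
exists (- Num.floor t - 1); rewrite intrB intrN mulr1z.
have -> : - (Num.floor t)%:~R - 1 + t = f - 1 by rewrite /f; ring.
(* If both roundings exceeded the bound, so would their average [avg]. Strictness comes from the
   weight [1 - f], as [f] may be 0. *)
rewrite leNgt; apply/negP => gt2.
have lt1 : 0 < (1 - f) * (enorm (x + f *: v) ^+ 2 -
    (enorm x ^+ 2 + 1 / 4 * enorm v ^+ 2)) by apply: mulr_gt0; lra.
have le2 : 0 <= f * (enorm (x + (f - 1) *: v) ^+ 2 -
    (enorm x ^+ 2 + 1 / 4 * enorm v ^+ 2)) by apply: mulr_ge0 => //; lra.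
lra.
Qed.

(** Coefficients are rounded one at a time, the part already treated being absorbed into [x];
    integral ones cost nothing. *)
Lemma exists_rounding {R : realType} {m : nat} (x : 'rV[R]_m)
    (v : nat -> 'rV[R]_m) (t : nat -> R) (j : nat) :
  exists d : nat -> int,
    enorm (x + \sum_(i < j) ((d i)%:~R + t i) *: v i) ^+ 2 <=
    enorm x ^+ 2 + 1 / 4 * \sum_(i < j | t i \isn't a Num.int) enorm (v i) ^+ 2.
Proof.
elim: j => [|j [d IH]].
  by exists (fun=> 0); rewrite !big_ord0 mulr0 !addr0.
have [e He] := exists_rounding1 (x + \sum_(i < j) ((d i)%:~R + t i) *: v i)
                                (v j) (t j).
exists (fun i => if i == j then e else d i).
rewrite big_ord_recr /= eqxx addrA.
under eq_bigr => i _ do rewrite ltn_eqF //.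
apply: (le_trans He); rewrite [in leRHS]big_mkcond [in leRHS]big_ord_recr /=.
rewrite -big_mkcond /=.
rewrite mulrDr addrA; apply: lerD => //.
by case: ifP => _ /=; rewrite ?mul0r ?mulr0.
Qed.

(** * Length bounds for Minkowski bases *)

Lemma minkowski_basis_le {R : realType} {m : nat} (L : set 'rV[R]_m)
    (v : seq 'rV[R]_m) (cs : seq int) (j : nat) :
  let w := \sum_(i < size v) v`_i *~ cs`_i in
  let g := foldr gcdz 0 (drop j cs) in
  minkowski_basis L v -> size cs = size v -> (j < size v)%N -> g != 0 ->
  enorm v`_j ^+ 2 <= enorm w ^+ 2 / g%:~R ^+ 2 +
    1 / 4 * \sum_(i < j | ~~ (g %| cs`_i)%Z) enorm v`_i ^+ 2.
Proof.
move=> w g [Lv vmin] szcs ltj gN0.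
have [b [Ew prim]] := primitive_gcd_decomposition L v cs j Lv szcs ltj.
rewrite -/w -/g in Ew.
have gR : g%:~R != 0 :> R by rewrite intr_eq0.
(* With this [t] the fractional coefficients of [w / g] cancel, leaving the lattice vector [x] with
   integer coefficients [d i]. *)
pose t (i : nat) : R := - ((cs`_i)%:~R / g%:~R).
have [d Hd] := exists_rounding (g%:~R^-1 *: w) (fun i => v`_i) t j.
set x := \sum_(i < j) v`_i *~ d i + b.
have Ex : g%:~R^-1 *: w + \sum_(i < j) ((d i)%:~R + t i) *: v`_i = x.
  rewrite Ew scalerDr -[b *~ g]scaler_int scalerA mulVf // scale1r scaler_sumr.
  rewrite addrAC -big_split /x; congr (_ + _); apply: eq_bigr => i _ /=.
  rewrite -[v`_i *~ _]scaler_int -[v`_i *~ d i]scaler_int scalerA -scalerDl; congr (_ *: _).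
  by rewrite /t; ring.
have Lx : L x.
  have [u [_ sub _]] := prim d; apply: sub => /=.
  by rewrite mem_cat mem_rcons mem_head.
have [_ /(_ x)] := vmin j ltj; rewrite /= => /(_ (conj Lx (prim d))) le1.
have le2 : enorm v`_j ^+ 2 <= enorm x ^+ 2.
  by rewrite ler_sqr ?nnegrE ?sqrtr_ge0.
apply: (le_trans le2); rewrite -Ex; apply: (le_trans Hd).
rewrite enormZ_sqr exprVn mulrC lerD2l ler_pM2l; last by lra.
rewrite big_mkcond [leRHS]big_mkcond; apply: ler_sum => i _.
have [/dvdzP[q Eq]|_] := boolP (g %| cs`_i)%Z; last first.
  by case: ifP => // _; apply: sqr_ge0.
rewrite ifF // /t Eq intrM mulfK // -intrN; apply/negbTE.
by rewrite negbK; apply/intrP; exists (- q).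
Qed.

(** More than [j] independent vectors cannot all lie in a span of dimension at most [j]. *)
Lemma exists_notin_span_take {R : realType} {m : nat} (L : set 'rV[R]_m)
    (v s : seq 'rV[R]_m) (j : nat) :
  lattice_basis L v -> free s -> [set` s] `<=` L -> (j < size s)%N ->
  exists w, exists cs : seq int,
    [/\ w \in s, size cs = size v, w = \sum_(i < size v) v`_i *~ cs`_i
      & w \notin <<take j v>>%VS].
Proof.
move=> /lattice_basisP[_ ->] fs sL ltj.
have [w ws wN] : exists2 w, w \in s & w \notin <<take j v>>%VS.
  apply/hasP; apply: contraLR ltj; rewrite -all_predC -leqNgt => /allP sv.
  rewrite -(eqP fs); apply: (leq_trans _ (leq_trans (dim_span (take j v)) _)).
    by apply/dimvS/span_subvP => x /sv /=; rewrite negbK.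
  by rewrite size_take; case: ltnP.
have /zspanP[c Ec] := sL _ ws.
exists w, (mkseq c (size v)); rewrite size_mkseq; split=> //.
by rewrite Ec; apply: eq_bigr => i _; rewrite nth_mkseq.
Qed.

(** The alternatives correspond to a tail gcd of absolute value 1, 2 or 3, and at least 4. In the
    second, [w / g] and each of the [j] earlier vectors contribute at most [r ^+ 2 / 4]. *)
Lemma minkowski_basis_step {R : realType} {m : nat} (L : set 'rV[R]_m)
    (v s : seq 'rV[R]_m) (r : R) (j : nat) :
  minkowski_basis L v -> free s -> [set` s] `<=` L ->
  (forall x, x \in s -> enorm x <= r) -> (j < size s)%N -> (j < size v)%N ->
  [\/ enorm v`_j ^+ 2 <= r ^+ 2,
      enorm v`_j ^+ 2 <= j.+1%:R / 4 * r ^+ 2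
    | enorm v`_j ^+ 2 <=
        1 / 16 * r ^+ 2 + 1 / 4 * \sum_(i < j) enorm v`_i ^+ 2].
Proof.
move=> vmin fs sL sr ltjs ltj; have [Lv _] := vmin.
have [w [cs [ws szcs Ew wN]]] := exists_notin_span_take _ v s j Lv fs sL ltjs.
have w_le : enorm w ^+ 2 <= r ^+ 2.
  have w0 : 0 <= enorm w := sqrtr_ge0 _.
  by rewrite ler_sqr ?nnegrE ?(le_trans w0) ?sr.
pose G i := foldr gcdz 0 (drop i cs).
(* A zero gcd would kill all coefficients from [i] on and put [w] in the span of [take j v]. *)
have GN0 i : (i <= j)%N -> G i != 0.
  move=> le_ij; apply: contraNneq wN => Gi0; rewrite Ew.
  apply: rpred_sum => l _; have [ltl|gel] := ltnP l j.
    apply/rpredMz/memv_span; rewrite -(nth_take 0 ltl) mem_nth //.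
    by rewrite size_take ltj.
  suff -> : cs`_l = 0 by rewrite mulr0z mem0v.
  have : (0 %| foldr gcdz 0 (drop i cs))%Z by rewrite -/(G i) Gi0 dvdzz.
  rewrite dvdz_foldr_gcdz => /allP/(_ cs`_l).
  rewrite dvd0z => H; apply/eqP/H.
  rewrite -(subnKC (leq_trans le_ij gel)) -nth_drop mem_nth // size_drop.
  by rewrite ltn_sub2r ?szcs // (leq_ltn_trans _ (ltn_ord l)) // (leq_trans le_ij).
have bound i (lti : (i <= j)%N) := minkowski_basis_le L v cs i vmin szcs
  (leq_ltn_trans lti ltj) (GN0 i lti).
rewrite -Ew in bound.
have sqr_intr (g : int) : g%:~R ^+ 2 = `|g|%N%:R ^+ 2 :> R.
  by rewrite natr_absz intr_norm real_normK ?num_real.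
have coprime_le i : (i < j)%N -> coprimez (G j) cs`_i -> enorm v`_i ^+ 2 <= r ^+ 2.
  move=> lti /eqP cop; have : (G i %| gcdz (G j) cs`_i)%Z.
    rewrite dvdz_gcd [X in X && _]dvdz_foldr_gcdz.
    have : (G i %| foldr gcdz 0 (drop i cs))%Z := dvdzz _.
    rewrite dvdz_foldr_gcdz (drop_nth 0) ?szcs ?(ltn_trans lti) //=.
    case/andP=> -> /allP H; rewrite andbT; apply/allP => c cj; apply: H.
    move: cj; rewrite -(subnK lti) -drop_drop; exact: mem_drop.
  rewrite cop dvdz1 => /eqP G1.
  have := bound i (ltnW lti); rewrite sqr_intr G1 expr1n divr1 big_pred0.
    by rewrite mulr0 addr0 => /le_trans; apply.
  by move=> l; rewrite dvdzE G1 dvd1n.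
have := bound j (leqnn j); rewrite sqr_intr.
have: (0 < `|G j|)%N by rewrite absz_gt0 GN0.
set p := `|G j|%N => p0 le_vj.
have r0 := sqr_ge0 r.
have [p4|p4] := leqP 4 p.
  apply: Or33; apply: (le_trans le_vj); apply: lerD.
    rewrite ler_pdivrMr ?exprn_gt0 ?ltr0n //.
    have : 4 <= p%:R :> R by rewrite ler_nat.
    move=> p4R; apply: (le_trans w_le).
    have : 16 <= p%:R ^+ 2 :> R by nra.
    by move=> /(ler_wpM2l r0); lra.
  apply: ler_wpM2l; first by lra.
  by rewrite [leLHS]big_mkcond; apply: ler_sum => i _; case: ifP => // _; apply: sqr_ge0.
have [p1|p1] := eqVneq p 1%N.
  apply: Or31; apply: le_trans le_vj _.
  rewrite p1 expr1n divr1 big_pred0 ?mulr0 ?addr0 //.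
  by move=> l; rewrite dvdzE -/p p1 dvd1n.
apply: Or32; apply: (le_trans le_vj).
have pp : prime p by case: (p) p0 p1 p4 => [|[|[|[|]]]].
have sum_le : \sum_(i < j | ~~ (G j %| cs`_i)%Z) enorm v`_i ^+ 2 <= j%:R * r ^+ 2.
  rewrite mulr_natl -[j in leRHS]card_ord -sumr_const big_mkcond.
  apply: ler_sum => i _; case: ifP => // ndvd; apply: coprime_le => //.
  by rewrite /coprimez /gcdz -/p; move: ndvd; rewrite dvdzE -/p -prime_coprime.
have : enorm w ^+ 2 / p%:R ^+ 2 <= r ^+ 2 / 4.
  rewrite ler_pdivrMr ?exprn_gt0 ?ltr0n //; apply: (le_trans w_le).
  have : 2 <= p%:R :> R by rewrite ler_nat; case: (p) p0 p1 => [|[|]].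
  move=> p2; have : 4 <= p%:R ^+ 2 :> R by nra.
  by move=> /(ler_wpM2l r0); lra.
by rewrite -(natr1 j); lra.
Qed.

(* The cases [j.+1%:R / 4] and [1] stay below the geometric bound; the last
   case is the induction [\sum_(i < n + 7) F i <= (19/2 (5/4)^n - 1) W]. *)
Lemma minkowski_length_recursion {R : realType} (F : nat -> R) (W : R) (k : nat) :
  0 <= W -> (8 <= k)%N ->
  (forall j, (j < k)%N ->
    [\/ F j <= W, F j <= j.+1%:R / 4 * W
      | F j <= 1 / 16 * W + 1 / 4 * \sum_(i < j) F i]) ->
  F k.-1 <= 608 / 625 * (5 / 4) ^+ (k - 4) * W.
Proof.
move=> W0 k8 step.
(* Here [n + 8] is [j.+1] for [j = n + 7]. The left side starts at [2 W] and grows by [W / 4], the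
   right side starts at [19/8 W] and grows faster. *)
have linear_le n : (n + 8)%:R / 4 * W <= 19 / 8 * ((5 / 4) ^+ n * W).
  elim: n => [|n IH]; first by rewrite expr0 add0n; lra.
  have ge1 : 1 <= (5 / 4) ^+ n :> R by apply: exprn_ege1; lra.
  have := ler_wpM2r W0 ge1; rewrite mul1r => geW.
  by rewrite exprS addSn -(natr1 (n + 8)) mulrDl mulrDl -!mulrA; lra.
(* The seven bounds add up to [4 + 5/4 + 3/2 + 7/4 = 17/2 = 19/2 - 1], the base case of [sum_le]. *)
have sum7 : \sum_(i < 7) F i <= (17 / 2) * W.
  have lt7 i : (i < 7)%N -> (i < k)%N by move=> /leq_trans->//; apply: ltnW.
  have F0 : F 0 <= W by case: (step 0 (lt7 0 isT)); rewrite ?big_ord0; lra.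
  have F1 : F 1 <= W.
    by case: (step 1 (lt7 1 isT)); rewrite ?big_ord_recr ?big_ord0 /=; lra.
  have F2 : F 2 <= W.
    by case: (step 2 (lt7 2 isT)); rewrite ?big_ord_recr ?big_ord0 /=; lra.
  have F3 : F 3 <= W.
    by case: (step 3 (lt7 3 isT)); rewrite ?big_ord_recr ?big_ord0 /=; lra.
  have F4 : F 4 <= 5 / 4 * W.
    by case: (step 4 (lt7 4 isT)); rewrite ?big_ord_recr ?big_ord0 /=; lra.
  have F5 : F 5 <= 3 / 2 * W.
    by case: (step 5 (lt7 5 isT)); rewrite ?big_ord_recr ?big_ord0 /=; lra.
  have F6 : F 6 <= 7 / 4 * W.
    by case: (step 6 (lt7 6 isT)); rewrite ?big_ord_recr ?big_ord0 /=; lra.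
  by rewrite !big_ord_recr big_ord0 /=; lra.
have F_le n : (n + 7 < k)%N ->
    \sum_(i < n + 7) F i <= 19 / 2 * ((5 / 4) ^+ n * W) - W ->
    F (n + 7) <= 19 / 8 * ((5 / 4) ^+ n * W).
  move=> ltk; have := linear_le n; rewrite addnS => linn.
  have : W <= (n + 7).+1%:R / 4 * W.
    rewrite -[leLHS]mul1r ler_wpM2r // ler_pdivlMr // mul1r ler_nat.
    by rewrite -addnS (leq_trans _ (leq_addl n 8)).
  by case: (step _ ltk); lra.
have sum_le n : (n + 7 <= k)%N ->
    \sum_(i < n + 7) F i <= 19 / 2 * ((5 / 4) ^+ n * W) - W.
  elim: n => [_|n IH ltk]; first by rewrite add0n expr0; lra.
  rewrite addSn big_ord_recr exprS -mulrA /=.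
  by have := IH (ltnW ltk); have := F_le _ ltk (IH (ltnW ltk)); lra.
have [n Ek] : exists n, k = (n + 8)%N by exists (k - 8)%N; rewrite subnK.
have ltk : (n + 7 < k)%N by rewrite Ek ltn_add2l.
have := F_le n ltk (sum_le n (ltnW ltk)).
(* The exponent becomes [n + 4], and [608/625 (5/4)^4 = 19/8]. *)
rewrite Ek -addnBA // addnS /= exprD.
by move=> /le_trans; apply; lra.
Qed.

Theorem corollary1p2 (R : realType) (m n k : nat) (L : set 'rV[R]_m)
    (v : n.-tuple 'rV[R]_m)
    (hk : (8 <= k)%N) (hkn : (k <= n)%N)
    (hL : is_lattice L) (hrank : has_rank L n) (hv : minkowski_basis L v) :
  enorm v`_k.-1 ^+ 2 <=
    608%:R / 625%:R * (5%:R / 4%:R) ^+ (k - 4) * succ_min L k ^+ 2.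
Proof.
have k_gt0 : (0 < k)%N by apply: leq_trans hk.
set C := 608%:R / 625%:R * (5%:R / 4%:R) ^+ (k - 4) : R.
have C0 : 0 < C by rewrite mulr_gt0 ?exprn_gt0 //; lra.
set E := [set r | exists s : k.-tuple 'rV[R]_m,
  [/\ free s, [set` s] `<=` L & forall x, x \in s -> enorm x <= r]].
(* Dividing by [Num.sqrt C] gives a lower bound of [E] itself, which passes to its infimum
   [succ_min L k]. *)
have lower r : E r -> enorm v`_k.-1 / Num.sqrt C <= r.
  case=> s [fs sL sr].
  have r0 : 0 <= r.
    by apply: le_trans (sr s`_0 _); rewrite ?sqrtr_ge0 ?mem_nth ?size_tuple.
  rewrite ler_pdivrMr ?sqrtr_gt0 // -ler_sqr ?nnegrE ?mulr_ge0 ?sqrtr_ge0 //.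
  rewrite exprMn [Num.sqrt C ^+ 2]sqr_sqrtr ?(ltW C0) // mulrC.
  apply: (@minkowski_length_recursion R (fun j => enorm v`_j ^+ 2)) => //.
    exact: sqr_ge0.
  move=> j ltj; apply: minkowski_basis_step hv fs sL sr _ _.
    by rewrite size_tuple.
  by rewrite size_tuple (leq_trans ltj).
(* The first [k] basis vectors are independent, and the sum of their lengths bounds each of them. *)
have E_nonempty : E !=set0.
  have [/lattice_basisP[fv EL] _] := hv.
  exists (\sum_(x <- take k v) enorm x).
  have szt : size (take k v) == k by rewrite size_takel ?size_tuple.
  exists (Tuple szt); split=> /=.
  - by move: fv; rewrite -{1}(cat_take_drop k v) => /catl_free.
  - by rewrite EL => x /mem_take; apply: mem_zspan.
  - move=> x xv; rewrite (big_rem x) //= lerDl sumr_ge0 // => y _.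
    exact: sqrtr_ge0.
have := lb_le_inf E_nonempty lower; rewrite -/(succ_min L k).
rewrite ler_pdivrMr ?sqrtr_gt0 // => le1.
have s0 : 0 <= succ_min L k * Num.sqrt C by apply: le_trans le1; apply: sqrtr_ge0.
move: le1; rewrite -ler_sqr ?nnegrE ?sqrtr_ge0 //.
by rewrite exprMn [Num.sqrt C ^+ 2]sqr_sqrtr ?(ltW C0) // mulrC.
Qed.
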